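(* Let $S$ be a non-empty set. Then there exist a unital vector lattice algebra $F$ and a map $j:S\to F$ with the property that, for any map $\varphi:S\to A$ from $S$ into a unital vector lattice algebra $A$, there exists a unique unital vector lattice algebra homomorphism $\overline{\varphi}:F\to A$ such that $\varphi=\overline{\varphi}\circ j$. Furthermore: (1) the pair $(j,F)$ is unique up to a unique compatible isomorphism: if $(j',F')$ is another pair with this property, then there is a unique isomorphism of unital vector lattice algebras $\psi:F\to F'$ such that $j'=\psi\circ j$; (2) $F$ equals its unital vector lattice subalgebra that is generated by $j(S)$; (3) the map $j$ is injective.
   Context: All vector spaces are over the real numbers. An algebra is an associative real algebra, not necessarily unital or commutative. A vector lattice algebra is a vector lattice that is also an algebra such that the product of two positive elements is positive. A unital vector lattice algebra is a vector lattice algebra with an identity element $1$ for the multiplication; $1$ is not required to be positive (and $1=0$ is not excluded). A unital vector lattice algebra homomorphism is a linear map between unital vector lattice algebras that is a lattice homomorphism, is multiplicative, and maps the identity element to the identity element. The unital vector lattice subalgebra generated by a subset is the smallest subset containing it and the identity element that is simultaneously a vector sublattice and a subalgebra. *)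

(* Defs.v *)
From HB Require Import structures.
From mathcomp Require Import all_boot all_order all_algebra.
From mathcomp Require Import all_classical all_reals.

Set Implicit Arguments.
Unset Strict Implicit.
Unset Printing Implicit Defensive.

Import Order.TTheory GRing.Theory Num.Theory.

Local Open Scope classical_set_scope.
Local Open Scope ring_scope.

(* The joins of [Order.Lattice] with [GRing.Lmodule], and of
   [Num.POrderedZmodule] with [GRing.PzRing], cannot be declared on top of the
   existing hierarchy (they would have to precede [Num.NumDomain]).  Hence meet,
   join, product and unit are fields of the two structures below, and the
   library's lattice and ring structures are then installed on their carriers,
   so that the library operations and notations apply from there on. *)
HB.mixin Record POrderedLmodule_isVectorLattice (R : realType) V
    of Num.POrderedZmodule V & GRing.Lmodule R V := {
  vl_meet : V -> V -> V;
  vl_join : V -> V -> V;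
  vl_lexI : forall x y z : V, (x <= vl_meet y z) = (x <= y) && (x <= z);
  vl_leUx : forall x y z : V, (vl_join x y <= z) = (x <= z) && (y <= z);
  vl_lerD2r : forall z x y : V, x <= y -> x + z <= y + z;
  vl_scaler_ge0 : forall (a : R) (x : V), 0 <= a -> 0 <= x -> 0 <= a *: x
}.

#[short(type="vectorLatticeType")]
HB.structure Definition VectorLattice (R : realType) :=
  {V of POrderedLmodule_isVectorLattice R V
      & Num.POrderedZmodule V & GRing.Lmodule R V}.

HB.instance Definition _ (R : realType) (V : vectorLatticeType R) :=
  Order.POrder_MeetJoin_isLattice.Build ring_display (VectorLattice.sort V)
    (@vl_lexI R V) (@vl_leUx R V).

(* Neither 1 != 0 (so [algType R] would not do) nor 0 <= 1 is required. *)
HB.mixin Record VectorLattice_isUnitalVLAlgebra (R : realType) A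
    of VectorLattice R A := {
  vla_one : A;
  vla_mul : A -> A -> A;
  vla_mulrA : associative vla_mul;
  vla_mul1r : left_id vla_one vla_mul;
  vla_mulr1 : right_id vla_one vla_mul;
  vla_mulrDl : left_distributive vla_mul +%R;
  vla_mulrDr : right_distributive vla_mul +%R;
  vla_scalerAl : forall (a : R) (x y : A),
    a *: vla_mul x y = vla_mul (a *: x) y;
  vla_scalerAr : forall (a : R) (x y : A),
    a *: vla_mul x y = vla_mul x (a *: y);
  vla_mulr_ge0 : forall x y : A, 0 <= x -> 0 <= y -> 0 <= vla_mul x y
}.

#[short(type="unitalVLAlgType")]
HB.structure Definition UnitalVLAlgebra (R : realType) :=
  {A of VectorLattice_isUnitalVLAlgebra R A & VectorLattice R A}.

HB.instance Definition _ (R : realType) (A : unitalVLAlgType R) :=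
  GRing.Zmodule_isPzRing.Build (UnitalVLAlgebra.sort A)
    (@vla_mulrA R A) (@vla_mul1r R A) (@vla_mulr1 R A)
    (@vla_mulrDl R A) (@vla_mulrDr R A).

HB.instance Definition _ (R : realType) (A : unitalVLAlgType R) :=
  Order.POrder_MeetJoin_isLattice.Build ring_display (UnitalVLAlgebra.sort A)
    (@vl_lexI R A) (@vl_leUx R A).

Section Definitions.
Variable R : realType.

Definition lattice_hom (V W : vectorLatticeType R) (f : V -> W) : Prop :=
  {morph f : x y / (x `&` y)%O} /\ {morph f : x y / (x `|` y)%O}.

Definition unital_vlalg_hom (A B : unitalVLAlgType R) (f : A -> B) : Prop :=
  [/\ linear f, lattice_hom f, {morph f : x y / x * y} & f 1 = 1].

Definition unital_vlalg_iso (A B : unitalVLAlgType R) (f : A -> B) : Prop :=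
  unital_vlalg_hom f /\ bijective f.

Definition linear_subspace (V : lmodType R) (B : set V) : Prop :=
  B 0 /\ forall (a : R) (x y : V), B x -> B y -> B (a *: x + y).

Definition vector_sublattice (V : vectorLatticeType R) (B : set V) : Prop :=
  [/\ linear_subspace B,
      forall x y : V, B x -> B y -> B (x `&` y)%O
    & forall x y : V, B x -> B y -> B (x `|` y)%O].

(* Not required to contain 1. *)
Definition subalgebra (A : unitalVLAlgType R) (B : set A) : Prop :=
  linear_subspace B /\ forall x y : A, B x -> B y -> B (x * y).

Definition generated_unital_vlsubalg (A : unitalVLAlgType R) (X : set A)
    : set A :=
  smallest (fun B : set A => vector_sublattice B /\ subalgebra B)
    ([set 1] `|` X).

Definition free_unital_vlalg (S : Type) (F : unitalVLAlgType R) (j : S -> F)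
    : Prop :=
  forall (A : unitalVLAlgType R) (phi : S -> A),
    exists! phibar : F -> A, unital_vlalg_hom phibar /\ phi = phibar \o j.

End Definitions.

(* Main.v *)
Require Import Defs.
From HB Require Import structures.
From mathcomp Require Import all_boot all_order all_algebra.
From mathcomp Require Import all_classical all_reals.

(** The free object is the algebra of terms over [S] in the signature of unital
    vector lattice algebras, modulo the identification of two terms that take
    the same value under every assignment of [S] into every unital vector
    lattice algebra.  The classes are ordered in the same way: one class lies
    below another when all its values do.  The values of terms thus form a
    jointly injective, order-reflecting family of maps that commute with the
    operations ([ev_inj], [ev_lin], [ev_mul], [ev_meet], [ev_join]), and every
    identity or inequality between terms that is valid in all unital vector
    lattice algebras, in particular each axiom, passes to the classes.

    This gives existence: [phi] extends to the evaluation [ev phi] of classes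
    of terms.  The class of a term is the value of that term at the generators
    ([class_eval]), and homomorphisms commute with taking values ([hom_eval]).
    Hence a homomorphism is determined by its restriction to the generators
    ([hom_ev]), which gives uniqueness, and the generators generate the whole
    algebra ([eval_generated]).  Two free pairs have mutually inverse
    comparison maps, so the pair is unique ([free_unique]).  Finally [S] embeds
    since the real line is a unital vector lattice algebra in which two
    distinct elements of [S] can be given different values ([fvar_inj]).

    Quantifying over all algebras in the congruence is harmless: the congruence
    is a proposition, so the size of the quotient is that of the set of
    terms. *)

Set Implicit Arguments.
Unset Strict Implicit.
Unset Printing Implicit Defensive.

Import Order.TTheory GRing.Theory Num.Theory.

Local Open Scope classical_set_scope.
Local Open Scope ring_scope.
Local Open Scope quotient_scope.

(** * Terms and their values *)

(** The vector space operations are merged into the single constructor [Lin],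
    for [a *: t + u], which is the form that linearity of maps and of subsets
    is expressed in; sums, opposites and multiples are recovered with [Zero]. *)
Inductive term (R S : Type) : Type :=
  | Var of S
  | Zero
  | One
  | Lin of R & term R S & term R S
  | Mul of term R S & term R S
  | Meet of term R S & term R S
  | Join of term R S & term R S.

Arguments Zero {R S}.
Arguments One {R S}.
Arguments Var {R S}.

Fixpoint eval (R : realType) (S : Type) (A : unitalVLAlgType R) (phi : S -> A)
    (t : term R S) : A :=
  match t with
  | Var s => phi s
  | Zero => 0
  | One => 1
  | Lin a t u => a *: eval phi t + eval phi u
  | Mul t u => eval phi t * eval phi u
  | Meet t u => (eval phi t `&` eval phi u)%O
  | Join t u => (eval phi t `|` eval phi u)%O
  end.

HB.instance Definition _ (R S : Type) := gen_eqMixin (term R S).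
HB.instance Definition _ (R S : Type) := gen_choiceMixin (term R S).

Section FreeAlgebra.
Variables (R : realType) (S : Type).

Definition same_values (t u : term R S) : bool :=
  `[< forall (A : unitalVLAlgType R) (phi : S -> A), eval phi t = eval phi u >].

Lemma same_values_refl : reflexive same_values.
Proof. by move=> t; apply/asboolP. Qed.

Lemma same_values_sym : symmetric same_values.
Proof. by move=> t u; apply/asboolP/asboolP => tu A phi; rewrite tu. Qed.

Lemma same_values_trans : transitive same_values.
Proof.
by move=> u t v /asboolP tu /asboolP uv; apply/asboolP => A phi; rewrite tu.
Qed.

Canonical same_values_equiv :=
  EquivRel same_values same_values_refl same_values_sym same_values_trans.

Definition free_vla : Type := {eq_quot same_values}.

HB.instance Definition _ := Choice.on free_vla.

Definition class (t : term R S) : free_vla := \pi_{eq_quot same_values} t.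

Definition rep (x : free_vla) : term R S := repr (x : {eq_quot same_values}).

Definition ev (A : unitalVLAlgType R) (phi : S -> A) (x : free_vla) : A :=
  eval phi (rep x).

Lemma repK : cancel rep class.
Proof. by move=> x; exact: reprK. Qed.

(** All members of a class have the same values, so the choice of
    representative in [ev] does not matter. *)
Lemma ev_class (A : unitalVLAlgType R) (phi : S -> A) (t : term R S) :
  ev phi (class t) = eval phi t.
Proof.
have : same_values (rep (class t)) t.
  by apply/eqmodP; rewrite -/(class _) repK.
by move/asboolP; apply.
Qed.

(** This joint injectivity is what transfers each equational axiom from all
    unital vector lattice algebras to the classes of terms. *)
Lemma ev_inj (x y : free_vla) :
  (forall (A : unitalVLAlgType R) (phi : S -> A), ev phi x = ev phi y) -> x = y.
Proof.
move=> xy; rewrite -(repK x) -(repK y).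
by apply/eqmodP/asboolP => A phi; exact: xy.
Qed.

(** * The algebra of classes of terms *)

Definition fvar (s : S) : free_vla := class (Var s).
Definition fzero : free_vla := class Zero.
Definition fone : free_vla := class One.
Definition flin (a : R) (x y : free_vla) := class (Lin a (rep x) (rep y)).
Definition fmul (x y : free_vla) := class (Mul (rep x) (rep y)).
Definition fmeet (x y : free_vla) := class (Meet (rep x) (rep y)).
Definition fjoin (x y : free_vla) := class (Join (rep x) (rep y)).
Definition fadd (x y : free_vla) := flin 1 x y.
Definition fopp (x : free_vla) := flin (-1) x fzero.
Definition fscale (a : R) (x : free_vla) := flin a x fzero.

Definition fle (x y : free_vla) : bool :=
  `[< forall (A : unitalVLAlgType R) (phi : S -> A), ev phi x <= ev phi y >].

Section Evaluation.
Variables (A : unitalVLAlgType R) (phi : S -> A).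

Lemma ev_var s : ev phi (fvar s) = phi s.
Proof. by rewrite ev_class. Qed.

Lemma ev_zero : ev phi fzero = 0.
Proof. by rewrite ev_class. Qed.

Lemma ev_one : ev phi fone = 1.
Proof. by rewrite ev_class. Qed.

Lemma ev_lin a x y : ev phi (flin a x y) = a *: ev phi x + ev phi y.
Proof. by rewrite ev_class. Qed.

Lemma ev_mul x y : ev phi (fmul x y) = ev phi x * ev phi y.
Proof. by rewrite ev_class. Qed.

Lemma ev_meet x y : ev phi (fmeet x y) = (ev phi x `&` ev phi y)%O.
Proof. by rewrite ev_class. Qed.

Lemma ev_join x y : ev phi (fjoin x y) = (ev phi x `|` ev phi y)%O.
Proof. by rewrite ev_class. Qed.

Lemma ev_add x y : ev phi (fadd x y) = ev phi x + ev phi y.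
Proof. by rewrite ev_lin scale1r. Qed.

Lemma ev_opp x : ev phi (fopp x) = - ev phi x.
Proof. by rewrite ev_lin ev_zero addr0 scaleN1r. Qed.

Lemma ev_scale a x : ev phi (fscale a x) = a *: ev phi x.
Proof. by rewrite ev_lin ev_zero addr0. Qed.

End Evaluation.

Let evE := (ev_var, ev_zero, ev_one, ev_mul, ev_meet, ev_join, ev_add, ev_opp,
  ev_scale).

Lemma faddA : associative fadd.
Proof. by move=> x y z; apply: ev_inj => A phi; rewrite !evE addrA. Qed.

Lemma faddC : commutative fadd.
Proof. by move=> x y; apply: ev_inj => A phi; rewrite !evE addrC. Qed.

Lemma fadd0 : left_id fzero fadd.
Proof. by move=> x; apply: ev_inj => A phi; rewrite !evE add0r. Qed.

Lemma faddN : left_inverse fzero fopp fadd.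
Proof. by move=> x; apply: ev_inj => A phi; rewrite !evE addNr. Qed.

HB.instance Definition _ :=
  GRing.isZmodule.Build free_vla faddA faddC fadd0 faddN.

Lemma fscaleA a b x : fscale a (fscale b x) = fscale (a * b) x.
Proof. by apply: ev_inj => A phi; rewrite !evE scalerA. Qed.

Lemma fscale1 : left_id 1 fscale.
Proof. by move=> x; apply: ev_inj => A phi; rewrite !evE scale1r. Qed.

Lemma fscaleDr : right_distributive fscale +%R.
Proof. by move=> a x y; apply: ev_inj => A phi; rewrite !evE scalerDr. Qed.

Lemma fscaleDl x : {morph fscale^~ x : a b / a + b}.
Proof. by move=> a b; apply: ev_inj => A phi; rewrite !evE scalerDl. Qed.

HB.instance Definition _ :=
  GRing.Zmodule_isLmodule.Build R free_vla fscaleA fscale1 fscaleDr fscaleDl.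

Lemma fle_refl : reflexive fle.
Proof. by move=> x; apply/asboolP. Qed.

Lemma fle_anti : antisymmetric fle.
Proof.
move=> x y /andP[/asboolP xy /asboolP yx]; apply: ev_inj => A phi.
by apply/le_anti; rewrite xy yx.
Qed.

Lemma fle_trans : transitive fle.
Proof.
move=> y x z /asboolP xy /asboolP yz; apply/asboolP => A phi.
exact: le_trans (xy A phi) (yz A phi).
Qed.

HB.instance Definition _ :=
  Order.Le_isPOrder.Build ring_display free_vla fle_refl fle_anti fle_trans.

Lemma fleP (x y : free_vla) :
  reflect (forall (A : unitalVLAlgType R) (phi : S -> A), ev phi x <= ev phi y)
    (x <= y).
Proof. exact: asboolP. Qed.

Lemma f_lexI (x y z : free_vla) : (x <= fmeet y z) = (x <= y) && (x <= z).
Proof.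
apply/fleP/andP => [xyz | [/fleP xy /fleP xz] A phi].
  by split; apply/fleP => A phi; move: (xyz A phi); rewrite evE lexI => /andP[].
by rewrite evE lexI xy xz.
Qed.

Lemma f_leUx (x y z : free_vla) : (fjoin x y <= z) = (x <= z) && (y <= z).
Proof.
apply/fleP/andP => [xyz | [/fleP xz /fleP yz] A phi].
  by split; apply/fleP => A phi; move: (xyz A phi); rewrite evE leUx => /andP[].
by rewrite evE leUx xz yz.
Qed.

Lemma f_lerD2r (z x y : free_vla) : x <= y -> x + z <= y + z.
Proof.
move=> /fleP xy; apply/fleP => A phi; rewrite !evE.
apply: vl_lerD2r; exact: xy.
Qed.

Lemma f_scaler_ge0 (a : R) (x : free_vla) : 0 <= a -> 0 <= x -> 0 <= a *: x.
Proof.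
move=> a0 /fleP x0; apply/fleP => A phi; rewrite !evE.
by apply: vl_scaler_ge0 => //; rewrite -(ev_zero phi); exact: x0.
Qed.

HB.instance Definition _ :=
  POrderedLmodule_isVectorLattice.Build R free_vla
    f_lexI f_leUx f_lerD2r f_scaler_ge0.

Lemma fmulA : associative fmul.
Proof. by move=> x y z; apply: ev_inj => A phi; rewrite !evE mulrA. Qed.

Lemma fmul1x : left_id fone fmul.
Proof. by move=> x; apply: ev_inj => A phi; rewrite !evE mul1r. Qed.

Lemma fmulx1 : right_id fone fmul.
Proof. by move=> x; apply: ev_inj => A phi; rewrite !evE mulr1. Qed.

Lemma fmulDl : left_distributive fmul +%R.
Proof. by move=> x y z; apply: ev_inj => A phi; rewrite !evE mulrDl. Qed.

Lemma fmulDr : right_distributive fmul +%R.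
Proof. by move=> x y z; apply: ev_inj => A phi; rewrite !evE mulrDr. Qed.

Lemma fscaleAl (a : R) (x y : free_vla) : a *: fmul x y = fmul (a *: x) y.
Proof. by apply: ev_inj => A phi; rewrite !evE; exact: vla_scalerAl. Qed.

Lemma fscaleAr (a : R) (x y : free_vla) : a *: fmul x y = fmul x (a *: y).
Proof. by apply: ev_inj => A phi; rewrite !evE; exact: vla_scalerAr. Qed.

Lemma fmul_ge0 (x y : free_vla) : 0 <= x -> 0 <= y -> 0 <= fmul x y.
Proof.
move=> /fleP x0 /fleP y0; apply/fleP => A phi; rewrite !evE.
by apply: vla_mulr_ge0; rewrite -(ev_zero phi); [exact: x0 | exact: y0].
Qed.

HB.instance Definition _ :=
  VectorLattice_isUnitalVLAlgebra.Build R free_vla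
    fmulA fmul1x fmulx1 fmulDl fmulDr fscaleAl fscaleAr fmul_ge0.

Lemma ev_hom (A : unitalVLAlgType R) (phi : S -> A) :
  unital_vlalg_hom (ev phi : (free_vla : unitalVLAlgType R) -> A).
Proof.
split.
- by move=> a x y; rewrite ev_add ev_scale.
- by split=> x y; [exact: ev_meet | exact: ev_join].
- by move=> x y; exact: ev_mul.
- exact: ev_one.
Qed.

End FreeAlgebra.


(** * Homomorphisms and term values *)

Lemma hom_id (R : realType) (A : unitalVLAlgType R) :
  unital_vlalg_hom (@id A).
Proof. by []. Qed.

Lemma hom_comp (R : realType) (A B C : unitalVLAlgType R)
    (g : B -> C) (f : A -> B) :
  unital_vlalg_hom g -> unital_vlalg_hom f -> unital_vlalg_hom (g \o f).
Proof.
move=> [gL [gI gU] gM g1] [fL [fI fU] fM f1]; split.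
- by move=> a x y /=; rewrite fL gL.
- by split=> x y /=; [rewrite fI gI | rewrite fU gU].
- by move=> x y /=; rewrite fM gM.
- by rewrite /= f1 g1.
Qed.

(** By induction on [t]: each constructor is an operation that [f] respects,
    and [Zero] is respected by linearity with coefficient [-1]. *)
Lemma hom_eval (R : realType) (S : Type) (A B : unitalVLAlgType R)
    (f : A -> B) (phi : S -> A) (t : term R S) :
  unital_vlalg_hom f -> f (eval phi t) = eval (f \o phi) t.
Proof.
move=> [fL [fI fU] fM f1].
have f0 : f 0 = 0 by have := fL (-1) 0 0; rewrite scaler0 addr0 scaleN1r addNr.
elim: t => [s|||a t IHt u IHu|t IHt u IHu|t IHt u IHu|t IHt u IHu] //=.
- by rewrite fL IHt IHu.
- by rewrite fM IHt IHu.
- by rewrite fI IHt IHu.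
- by rewrite fU IHt IHu.
Qed.

Lemma eval_generated (R : realType) (S : Type) (A : unitalVLAlgType R)
    (phi : S -> A) (t : term R S) :
  generated_unital_vlsubalg (range phi) (eval phi t).
Proof.
move=> B [[[[B0 Blin] BI BU] [_ BM]] sB].
elim: t => /= [s|||a t IHt u IHu|t IHt u IHu|t IHt u IHu|t IHt u IHu].
- by apply: sB; right; exists s.
- exact: B0.
- by apply: sB; left.
- exact: Blin.
- exact: BM.
- exact: BI.
- exact: BU.
Qed.

(** * The universal property *)

Section UniversalProperty.
Variables (R : realType) (S : Type).

Let F : unitalVLAlgType R := free_vla R S.
Let j : S -> F := @fvar R S.

(** Both sides have the same values, because [ev phi] is a homomorphism that
    sends the generators to their images under [phi]. *)
Lemma class_eval (t : term R S) : class t = eval j t.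
Proof.
apply: ev_inj => A phi; rewrite ev_class (hom_eval j t (ev_hom phi)).
by congr eval; apply/funext => s; rewrite /= ev_var.
Qed.

(** Uniqueness in the universal property: [f] is recovered from its restriction
    to the generators. *)
Lemma hom_ev (A : unitalVLAlgType R) (f : F -> A) :
  unital_vlalg_hom f -> f = ev (f \o j).
Proof.
by move=> fH; apply/funext => x; rewrite -{1}(repK x) class_eval hom_eval.
Qed.

Lemma free_fvar : free_unital_vlalg j.
Proof.
move=> A phi; exists (ev phi); split.
  by split; [exact: ev_hom | apply/funext => s; rewrite /= ev_var].
by move=> f [fH ->]; rewrite -hom_ev.
Qed.

Lemma fvar_generates : generated_unital_vlsubalg (range j) = [set: F].
Proof.
apply/seteqP; split=> // x _.
by rewrite -(repK x) class_eval; exact: eval_generated.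
Qed.

End UniversalProperty.

(** This rigidity makes comparison maps between free pairs inverse to each
    other. *)
Lemma free_hom_id (R : realType) (S : Type) (F : unitalVLAlgType R)
    (j : S -> F) (f : F -> F) :
  free_unital_vlalg j -> unital_vlalg_hom f -> j = f \o j -> f = id.
Proof.
move=> jF fH jf; have [g [_ guniq]] := jF F j.
by rewrite -(guniq f) // -(guniq id) //; split => //; exact: hom_id.
Qed.

Lemma free_unique (R : realType) (S : Type) (F F' : unitalVLAlgType R)
    (j : S -> F) (j' : S -> F') :
  free_unital_vlalg j -> free_unital_vlalg j' ->
  exists! psi : F -> F', unital_vlalg_iso psi /\ j' = psi \o j.
Proof.
move=> jF jF'.
have [psi [[psiH psij] psi_uniq]] := jF F' j'.
have [psi' [[psiH' psij'] _]] := jF' F j.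
exists psi; split; last by move=> f [[fH _] fj]; exact: psi_uniq.
split=> //; split=> //; exists psi' => x.
  suff /(congr1 (@^~ x)) : psi' \o psi = id by [].
  by apply: (free_hom_id jF); [exact: hom_comp | rewrite -compA -psij].
suff /(congr1 (@^~ x)) : psi \o psi' = id by [].
by apply: (free_hom_id jF'); [exact: hom_comp | rewrite -compA -psij'].
Qed.

(** * Embedding of the generators *)

Section RealLine.
Variable R : realType.

(** A copy of the regular module, so that scaling is multiplication and the
    axioms on scalars are ring laws. *)
Definition real_line : Type := R^o.

HB.instance Definition _ := GRing.Lmodule.on real_line.
HB.instance Definition _ := Order.POrder.copy real_line R.

HB.instance Definition _ :=
  POrderedLmodule_isVectorLattice.Build R real_line
    (@lexI _ R) (@leUx _ R)
    (fun z x y xy => etrans (lerD2r z x y) xy : (x : R) + z <= y + z)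
    (@mulr_ge0 R).

HB.instance Definition _ :=
  VectorLattice_isUnitalVLAlgebra.Build R real_line
    (@mulrA R) (@mul1r R) (@mulr1 R) (@mulrDl R) (@mulrDr R)
    (@mulrA R) (@mulrCA R) (@mulr_ge0 R).

End RealLine.

(** Evaluation at the indicator function of [s] in the real line tells [s] from
    every other generator. *)
Lemma fvar_inj (R : realType) (S : Type) : injective (@fvar R S).
Proof.
move=> s s' ss'.
pose phi s1 : (real_line R : unitalVLAlgType R) :=
  if `[< s1 = s >] then (1 : R) else (0 : R).
have := congr1 (ev phi) ss'; rewrite !ev_var /phi asboolT //.
by case: asboolP => [-> // | _ /eqP]; rewrite (oner_eq0 R).
Qed.

Theorem theorem6p1 (R : realType) (S : Type) (hS : inhabited S) :
  exists (F : unitalVLAlgType R) (j : S -> F),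
    [/\ free_unital_vlalg j,
        forall (F' : unitalVLAlgType R) (j' : S -> F'),
          free_unital_vlalg j' ->
          exists! psi : F -> F', unital_vlalg_iso psi /\ j' = psi \o j,
        generated_unital_vlsubalg (range j) = [set: F]
      & injective j].
Proof.
exists (free_vla R S : unitalVLAlgType R), (@fvar R S); split.
- exact: free_fvar.
- by move=> F' j'; apply: free_unique; exact: free_fvar.
- exact: fvar_generates.
- exact: fvar_inj.
Qed.
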